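(* Let $k \geq 1$, let $p_1 < p_2 < \dots < p_k$ be the first $k$ prime numbers and $P_k = \prod_{i=1}^k p_i$. Let $r_1, \ldots, r_k$ be arbitrary integers (a residue class $r_i$ modulo $p_i$ for each $i$), and for $1 \le n \le P_k$ let $\gamma(n) = \#\{ i \in \{1,\dots,k\} : n \equiv r_i \pmod{p_i}\}$. Then, for every such choice of $r_1,\dots,r_k$, $$\#\{ n \in \{1,\dots,P_k\} : \gamma(n) \le 1\} = a_k \quad\text{and}\quad \#\{ n \in \{1,\dots,P_k\} : \gamma(n) = 0\} = f_k,$$ where $a_k$ is the determinant of the $k\times k$ matrix with diagonal entries $p_1,\dots,p_k$ and all off-diagonal entries equal to $1$, and $f_k = (-1)^k \det M_k$, where $M_k$ is the $(k+1)\times(k+1)$ matrix whose first row consists entirely of ones and, for $1 \le i \le k$, whose row $i+1$ has entry $p_i$ in column $i$ and entry $1$ in every other column (so in particular the last column consists entirely of ones).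
   Context: Integers $n$ with $\gamma(n)\le 1$ are called available and those with $\gamma(n)=0$ are called free. *)

(* Defs.v *)
From mathcomp Require Import all_boot all_order all_algebra.
Set Implicit Arguments.
Unset Strict Implicit.
Unset Printing Implicit Defensive.
Import GRing.Theory.

Lemma next_prime_ex (n : nat) : exists q : nat, (n < q) && prime q.
Proof. by have [q lt_nq pr_q] := prime_above n; exists q; rewrite lt_nq pr_q. Qed.

Definition next_prime (n : nat) : nat := ex_minn (next_prime_ex n).

(* Indices start at 0: [nth_prime i] is the prime p_(i+1), so that           *)
(* nth_prime 0 = 2, nth_prime 1 = 3, nth_prime 2 = 5.                        *)
Definition nth_prime (i : nat) : nat := iter i.+1 next_prime 0.

Definition primorial (k : nat) : nat := \prod_(i < k) nth_prime i.

Definition gamma (k : nat) (r : 'I_k -> int) (n : nat) : nat :=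
  #|[set i : 'I_k | (n%:Z == r i %[mod (nth_prime i)%:Z])%Z]|.

Definition available (k : nat) (r : 'I_k -> int) (n : nat) : bool :=
  gamma r n <= 1.

Definition free_int (k : nat) (r : 'I_k -> int) (n : nat) : bool :=
  gamma r n == 0.

Local Open Scope ring_scope.

Definition avail_mx (k : nat) : 'M[int]_k :=
  \matrix_(i < k, j < k) if i == j then (nth_prime i)%:Z else 1.

(* With rows and columns numbered from 0, the entry p_i in row i+1 and       *)
(* column i becomes [nth_prime j] in row j+1 and column j.                   *)
Definition free_mx (k : nat) : 'M[int]_k.+1 :=
  \matrix_(i < k.+1, j < k.+1)
    if (i : nat) == j.+1 then (nth_prime j)%:Z else 1.

Definition avail_det (k : nat) : int := \det (avail_mx k).

Definition free_det (k : nat) : int := (-1) ^+ k * \det (free_mx k).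

(* Main.v *)
Require Import Defs.
From mathcomp Require Import all_boot all_order all_algebra.
From mathcomp Require Import perm.
Set Implicit Arguments.
Unset Strict Implicit.
Unset Printing Implicit Defensive.
Import GRing.Theory.
Local Open Scope ring_scope.

(** Let [p i] be the moduli.  By the Chinese remainder theorem, for each set [S]
    of indices, [\prod_(i | i \notin S) (p i - 1)] integers of a period lie in
    the chosen residue class modulo [p i] exactly when [i] is in [S].  Taking [S]
    empty or a singleton, the free integers number [\prod_i (p i - 1)] and the
    available ones [\prod_i (p i - 1) + \sum_i \prod_(j | j != i) (p j - 1)].
    The latter is the determinant of the diagonal matrix of the [p i - 1] plus
    the rank one matrix of ones, that is, [avail_det].  Cycling the columns of
    the second matrix turns it into one of the same shape with an additional
    diagonal entry [1]; this entry minus one vanishes, so that a single term of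
    the formula survives. *)

Section ChineseRemainder.

Variables (I : eqType) (p : I -> nat).

Lemma coprime_prodr (m : nat) (s : seq I) :
  {in s, forall i, coprime m (p i)} -> coprime m (\prod_(i <- s) p i).
Proof.
move=> co_mp; rewrite big_seq; elim/big_ind: _ => //; first exact: coprimen1.
by move=> a b; rewrite coprimeMr => -> ->.
Qed.

Lemma chinese_remainder_prod (s : seq I) (x y : nat) :
    uniq s -> {in s &, forall i j, i != j -> coprime (p i) (p j)} ->
  (x == y %[mod \prod_(i <- s) p i])%N = all (fun i => x == y %[mod p i])%N s.
Proof.
elim: s => [|i s IHs] /= => [_ _|/andP[s'i uniq_s] co_p].
  by rewrite big_nil !modn1.
rewrite big_cons chinese_remainder; last first.
  apply: coprime_prodr => j s_j.
  apply: co_p; rewrite ?inE ?eqxx ?s_j ?orbT //.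
  by apply: contraNneq s'i => ->.
by rewrite IHs // => j l s_j s_l; apply: co_p; rewrite inE ?s_j ?s_l orbT.
Qed.

End ChineseRemainder.

Lemma card_residue_class (m : nat) (x : int) :
  (0 < m)%N -> #|[set a : 'I_m | (a == x %[mod m])%Z]| = 1%N.
Proof.
move=> m_gt0; have m_neq0 : m%:Z != 0 by rewrite eqz_nat -lt0n.
have x_lt : (`|(x %% m)%Z| < m)%N.
  by rewrite -ltz_nat gez0_abs ?modz_ge0 // ltz_pmod ?ltz_nat.
apply/eqP/cards1P; exists (Ordinal x_lt); apply/setP => a; rewrite !inE.
by rewrite -val_eqE /= modz_nat modn_small // -eqz_nat gez0_abs // modz_ge0.
Qed.

Section Residues.

Variables (I : finType) (p : I -> nat).
Hypothesis p_gt0 : forall i, (0 < p i)%N.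
Hypothesis p_coprime : forall i j, i != j -> coprime (p i) (p j).

Definition residues (n : 'I_(\prod_i p i)) : {dffun forall i, 'I_(p i)} :=
  [ffun i => Ordinal (ltn_pmod n (p_gt0 i))].

Lemma residues_bij : bijective residues.
Proof.
apply: inj_card_bij => [x y eq_xy|]; last first.
  rewrite card_dep_ffun foldrE big_image card_ord.
  by under eq_bigr do rewrite card_ord.
apply/val_inj/eqP => /=.
rewrite -(modn_small (ltn_ord x)) -(modn_small (ltn_ord y)).
rewrite chinese_remainder_prod ?index_enum_uniq //; last first.
  by move=> i j _ _; apply: p_coprime.
apply/allP => i _; apply/eqP.
by move/ffunP/(_ i)/(congr1 val): eq_xy; rewrite !ffunE.
Qed.

Lemma card_residues_in (A : forall i, {set 'I_(p i)}) :
  #|[set n | [forall i, residues n i \in A i]]| = (\prod_i #|A i|)%N.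
Proof.
pose choices : simpl_pred {dffun forall i, 'I_(p i)} :=
  family (fun i => mem (A i)).
transitivity #|choices|.
  rewrite -(on_card_preimset (onW_bij _ residues_bij)).
  by apply: eq_card => n; rewrite !inE.
by rewrite card_family foldrE big_image.
Qed.

Variable r : I -> int.

Definition hit_moduli (n : nat) : {set I} := [set i | (n == r i %[mod p i])%Z].

Lemma card_hit_moduli_eq (S : {set I}) :
  #|[set n : 'I_(\prod_i p i) | hit_moduli n == S]|
    = (\prod_(i | i \notin S) (p i).-1)%N.
Proof.
pose residue_class i := [set a : 'I_(p i) | (a == r i %[mod p i])%Z].
pose A i := if i \in S then residue_class i else ~: residue_class i.
have class_residues n i :
    (residues n i \in residue_class i) = (i \in hit_moduli n).
  by rewrite !inE ffunE /= -modz_nat modz_mod.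
have A_residues n i :
    (residues n i \in A i) = ((i \in hit_moduli n) == (i \in S)).
  rewrite /A; case: (i \in S); first by rewrite class_residues eqb_id.
  by rewrite in_setC class_residues eqbF_neg.
transitivity #|[set n | [forall i, residues n i \in A i]]|.
  apply: eq_card => n; rewrite !inE; apply/eqP/forallP => [hit_n i|A_n].
    by rewrite A_residues hit_n.
  by apply/setP => i; apply/eqP; rewrite -A_residues.
rewrite card_residues_in [RHS]big_mkcond; apply: eq_bigr => i _ /=.
rewrite /A; case: ifP => _; first exact: card_residue_class.
by rewrite cardsCs setCK card_ord card_residue_class // subn1.
Qed.

Lemma card_hit_moduli_eq0 :
  #|[set n : 'I_(\prod_i p i) | #|hit_moduli n| == 0]|%N = (\prod_i (p i).-1)%N.
Proof.
transitivity #|[set n : 'I_(\prod_i p i) | hit_moduli n == set0]|.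
  by apply: eq_card => n; rewrite !inE cards_eq0.
by rewrite card_hit_moduli_eq; apply: eq_bigl => i; rewrite inE.
Qed.

Lemma card_hit_moduli_eq1 :
  #|[set n : 'I_(\prod_i p i) | #|hit_moduli n| == 1]|%N
    = (\sum_i \prod_(j | j != i) (p j).-1)%N.
Proof.
transitivity (\sum_i #|[set n : 'I_(\prod_i p i) | hit_moduli n == [set i]]|)%N.
  under [RHS]eq_bigr do rewrite -sum1dep_card big_mkcond.
  rewrite exchange_big -sum1dep_card big_mkcond; apply: eq_bigr => n _ /=.
  case: cards1P => [[i ->]|hit_n].
    rewrite -big_mkcond (big_pred1 i) // => j.
    by rewrite (inj_eq set1_inj) eq_sym.
  by rewrite big1 // => i _; case: eqP => // hit_i; case: hit_n; exists i.
apply: eq_bigr => i _; rewrite card_hit_moduli_eq.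
by apply: eq_bigl => j; rewrite inE.
Qed.

Lemma card_hit_moduli_le1 :
  #|[set n : 'I_(\prod_i p i) | #|hit_moduli n| <= 1]|%N
    = (\prod_i (p i).-1 + \sum_i \prod_(j | j != i) (p j).-1)%N.
Proof.
rewrite -card_hit_moduli_eq0 -card_hit_moduli_eq1 -cardsUI.
rewrite [X in (_ + X)%N]eq_card0 => [|n]; last by rewrite !inE; case: #|_|.
by rewrite addn0; apply: eq_card => n; rewrite !inE; case: #|_| => [|[]].
Qed.

Lemma hit_moduli_period : hit_moduli (\prod_i p i) = hit_moduli 0.
Proof.
apply/setP => i; rewrite !inE !modz_nat mod0n.
by rewrite (bigD1 i) //= modnMr.
Qed.

End Residues.

Lemma card_shift_period (m : nat) (Q : pred nat) : Q m = Q 0%N ->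
  #|[set n : 'I_m.+1 | (0 < n)%N && Q n]| = #|[set n : 'I_m | Q n]|.
Proof.
case: m => [|m] Q_period.
  by rewrite !eq_card0 // => [[]//|n]; rewrite inE ord1.
rewrite -!sum1dep_card big_mkcond [RHS]big_mkcond.
rewrite big_ord_recl [RHS]big_ord_recl big_ord_recr /= /bump !add1n -Q_period.
by rewrite add0n addnC.
Qed.

Section RankOneUpdate.

Variable R : comNzRingType.

Lemma det_block_add_corner (k : nat) (s t : 'M[R]_1) (u : 'rV_k) (v : 'cV_k)
    (A : 'M_k) :
  \det (block_mx (s + t) u v A)
    = \det s * \det A + \det (block_mx t u v A).
Proof.
have eq_row' (a b : 'M_1) (w x : 'rV_k) :
    row' (lshift k ord0) (block_mx a w v A)
      = row' (lshift k ord0) (block_mx b x v A).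
  by rewrite !row'Ku [row' _ (row_mx a w)]flatmx0 [row' _ (row_mx b x)]flatmx0.
rewrite -(det_lblock s v A) -[\det (block_mx s _ _ _)]mul1r.
rewrite -[\det (block_mx t _ _ _)]mul1r.
apply: (@determinant_multilinear R (1 + k) _ _ _ (lshift k ord0)) => //.
by rewrite !rowKu !row_id !scale1r add_row_mx add0r.
Qed.

Lemma det_block_mul_border (m k : nat) (a b : 'M[R]_m) (u : 'M_(k, m))
    (v : 'M_(m, k)) (A : 'M_k) :
  \det (block_mx (a *m b) (a *m v) (u *m b) (A + u *m v))
    = \det a * \det b * \det A.
Proof.
have -> : block_mx (a *m b) (a *m v) (u *m b) (A + u *m v)
    = block_mx a 0 u 1%:M *m block_mx b v 0 A.
  by rewrite mulmx_block !mul0mx !mulmx0 !mul1mx !addr0 addrC.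
by rewrite det_mulmx det_lblock det_ublock det1 mulr1 mulrA.
Qed.

Lemma det_diagD_rank1_recl (k : nat) (d0 : 'M[R]_1) (d : 'rV_k)
    (u0 v0 : 'M_1) (u : 'cV_k) (v : 'rV_k) :
  \det (diag_mx (row_mx d0 d) + col_mx u0 u *m row_mx v0 v)
    = d0 0 0 * \det (diag_mx d + u *m v) + u0 0 0 * v0 0 0 * \prod_i d 0 i.
Proof.
rewrite diag_mx_row mul_col_row add_block_mx !add0r det_block_add_corner.
by rewrite det_block_mul_border !det_diag big_ord1 !det_mx11.
Qed.

Lemma det_diagD_rank1 (k : nat) (d : 'rV[R]_k) (u : 'cV_k) (v : 'rV_k) :
  \det (diag_mx d + u *m v)
    = \prod_i d 0 i + \sum_i u i 0 * v 0 i * \prod_(j | j != i) d 0 j.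
Proof.
elim: k => [|k IHk] in d u v *; first by rewrite det_mx00 !big_ord0 addr0.
rewrite -[d in LHS](@hsubmxK _ 1 1 k) -[u in LHS](@vsubmxK _ 1 k 1).
rewrite -[v in LHS](@hsubmxK _ 1 1 k) det_diagD_rank1_recl IHk.
have rsubmxE (w : 'rV_(1 + k)) i : rsubmx w 0 i = w 0 (lift ord0 i).
  by rewrite mxE rshift1.
have dsubmxE (w : 'cV_(1 + k)) i : dsubmx w i 0 = w (lift ord0 i) 0.
  by rewrite mxE rshift1.
have prod_neq0 : \prod_(j | j != ord0) d 0 j = \prod_i d 0 (lift ord0 i).
  by rewrite big_mkcond big_ord_recl /= mul1r.
have prod_neq_lift i : \prod_(j | j != lift ord0 i) d 0 j
    = d 0 ord0 * \prod_(j | j != i) d 0 (lift ord0 j).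
  rewrite big_mkcond big_ord_recl /= [X in _ = _ * X]big_mkcond.
  by under eq_bigr do rewrite (inj_eq lift_inj).
rewrite !mxE !lshift0 mulrDr -addrA [X in _ + X]addrC mulr_sumr.
under eq_bigr do rewrite rsubmxE.
rewrite [\prod_i d 0 i]big_ord_recl [\sum_i u i 0 * _ * _]big_ord_recl.
rewrite prod_neq0; congr (_ + (_ + _)).
apply: eq_bigr => i _; rewrite prod_neq_lift dsubmxE rsubmxE mulrCA.
by under eq_bigr do rewrite rsubmxE.
Qed.

Definition offdiag1_mx (k : nat) (a : 'I_k -> R) : 'M[R]_k :=
  \matrix_(i, j) if i == j then a i else 1.

Lemma det_offdiag1 (k : nat) (a : 'I_k -> R) :
  \det (offdiag1_mx a)
    = \prod_i (a i - 1) + \sum_i \prod_(j | j != i) (a j - 1).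
Proof.
have -> : offdiag1_mx a
    = diag_mx (\row_i (a i - 1)) + const_mx 1 *m (const_mx 1 : 'rV_k).
  apply/matrixP => i j; rewrite !mxE big_ord1 !mxE mulr1.
  by case: eqP => [->|_]; rewrite ?subrK ?add0r.
rewrite det_diagD_rank1; under eq_bigr do rewrite mxE; congr (_ + _).
apply: eq_bigr => i _; rewrite !mxE !mul1r.
by under eq_bigr do rewrite mxE.
Qed.

Lemma det_offdiag1_eq1 (k : nat) (a : 'I_k -> R) (i0 : 'I_k) :
  a i0 = 1 -> \det (offdiag1_mx a) = \prod_(i | i != i0) (a i - 1).
Proof.
move=> a_i0; rewrite det_offdiag1 (bigD1 i0) //= a_i0 subrr mul0r add0r.
rewrite (bigD1 i0) //= [X in _ + X]big1 ?addr0 // => i i_neq.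
by rewrite (bigD1 i0) 1?eq_sym //= a_i0 subrr mul0r.
Qed.

Lemma det_subdiag_ones (k : nat) (a : nat -> R) :
  \det (\matrix_(i < k.+1, j < k.+1) if (i : nat) == j.+1 then a j else 1)
    = (-1) ^+ k * \prod_(i < k) (a i - 1).
Proof.
pose b (i : 'I_k.+1) := if (i : nat) is j.+1 then a j else 1.
pose col_cycle := lift_perm ord_max ord0 1 : 'S_k.+1.
rewrite [X in \det X](_ : _ = col_perm col_cycle (offdiag1_mx b)); last first.
  apply/matrixP => i j; rewrite !mxE; case: (unliftP ord_max j) => [j' ->|->].
    rewrite lift_perm_lift perm1 -val_eqE /= /bump leqNgt ltn_ord.
    by case: eqP => //; rewrite /b => ->.
  by rewrite lift_perm_id ltn_eqF ?ltn_ord //; case: eqP => // ->.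
rewrite col_permE det_mulmx det_perm odd_permV odd_lift_perm odd_perm1.
rewrite addbF /= addbF signr_odd mulrC (@det_offdiag1_eq1 _ b ord0) //.
by rewrite big_mkcond big_ord_recl /= mul1r.
Qed.

End RankOneUpdate.

Lemma next_primeP (n : nat) : (n < next_prime n)%N && prime (next_prime n).
Proof. by rewrite /next_prime; case: ex_minnP. Qed.

Lemma nth_prime_prime (i : nat) : prime (nth_prime i).
Proof. by have /andP[] := next_primeP (iter i next_prime 0%N). Qed.

Lemma nth_prime_gt0 (i : nat) : (0 < nth_prime i)%N.
Proof. exact/prime_gt0/nth_prime_prime. Qed.

Lemma ltn_nth_prime : {homo nth_prime : i j / (i < j)%N}.
Proof.
apply: homo_ltn => [y x z|i]; first exact: ltn_trans.
by have /andP[] := next_primeP (nth_prime i).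
Qed.

Lemma coprime_nth_prime (i j : nat) :
  i != j -> coprime (nth_prime i) (nth_prime j).
Proof.
rewrite prime_coprime ?dvdn_prime2 ?nth_prime_prime //.
by rewrite (inj_eq (incn_inj (leq_mono ltn_nth_prime))).
Qed.

Section FirstPrimes.

Variable k : nat.

Lemma gamma_period (r : 'I_k -> int) : gamma r (primorial k) = gamma r 0.
Proof. by congr #|pred_of_set _|; apply: hit_moduli_period. Qed.

Lemma card_free (r : 'I_k -> int) :
  #|[set n : 'I_(primorial k).+1 | (0 < n)%N && free_int r n]|
    = (\prod_(i < k) (nth_prime i).-1)%N.
Proof.
rewrite (@card_shift_period _ (free_int r)); last first.
  by rewrite /free_int gamma_period.
apply: card_hit_moduli_eq0 => [i|i j]; first exact: nth_prime_gt0.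
exact: coprime_nth_prime.
Qed.

Lemma card_available (r : 'I_k -> int) :
  #|[set n : 'I_(primorial k).+1 | (0 < n)%N && available r n]|
    = (\prod_(i < k) (nth_prime i).-1
       + \sum_(i < k) \prod_(j < k | j != i) (nth_prime j).-1)%N.
Proof.
rewrite (@card_shift_period _ (available r)); last first.
  by rewrite /available gamma_period.
apply: card_hit_moduli_le1 => [i|i j]; first exact: nth_prime_gt0.
exact: coprime_nth_prime.
Qed.

Lemma prod_pred_nth_prime (P : pred 'I_k) :
  (\prod_(i < k | P i) (nth_prime i).-1)%N%:Z
    = \prod_(i < k | P i) ((nth_prime i)%:Z - 1).
Proof.
rewrite -natz natr_prod; apply: eq_bigr => i _.
by rewrite natz predn_int ?nth_prime_gt0.
Qed.

Lemma avail_detE :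
  avail_det k = (\prod_(i < k) (nth_prime i).-1
    + \sum_(i < k) \prod_(j < k | j != i) (nth_prime j).-1)%N%:Z.
Proof.
rewrite [LHS](det_offdiag1 (fun i : 'I_k => (nth_prime i)%:Z)).
rewrite PoszD prod_pred_nth_prime -[X in _ = _ + X]natz natr_sum.
by under [X in _ = _ + X]eq_bigr do rewrite natz prod_pred_nth_prime.
Qed.

Lemma free_detE : free_det k = (\prod_(i < k) (nth_prime i).-1)%N%:Z.
Proof.
rewrite /free_det [\det _](det_subdiag_ones k (fun j => (nth_prime j)%:Z)).
by rewrite signrMK prod_pred_nth_prime.
Qed.

End FirstPrimes.

Theorem theorem1 (k : nat) (hk : (0 < k)%N) (r : 'I_k -> int) :
  #|[set n : 'I_(primorial k).+1 | (0 < n)%N && available r n]|%:Z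
    = avail_det k
  /\
  #|[set n : 'I_(primorial k).+1 | (0 < n)%N && free_int r n]|%:Z
    = free_det k.
Proof. by rewrite card_available card_free avail_detE free_detE. Qed.
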